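(* The logic AMLFI1 is sound: for every $\Gamma \cup \{\alpha\} \subseteq \mathcal{L}_{AM}$, if $\Gamma \vdash_{AMLFI1} \alpha$, then $\Gamma \vDash_{AMLFI1} \alpha$.
   Context: **Language.** $P$ is a countable set of propositional variables and $N$ a finite set of agents. The formulas of $\mathcal{L}_{AM}$ and the action models are defined by simultaneous recursion. Formulas: $\alpha ::= p \mid \neg\alpha \mid \bullet\alpha \mid (\alpha\land\alpha) \mid K_i\alpha \mid [U,e]\alpha$, with $p\in P$, $i\in N$, $U$ an action model and $e$ an action of $U$. An action model is $U=\langle E,\{\sim_i\}_{i\in N},\mathrm{pre}\rangle$ with $E$ a finite non-empty set of actions, each $\sim_i$ an equivalence relation on $E$, and $\mathrm{pre}:E\to\mathcal{L}_{AM}$ (preconditions). **Abbreviations.** $\circ\alpha:=\neg\bullet\alpha$; $\alpha\lor\beta:=\neg(\neg\alpha\land\neg\beta)$; $\sim\!\alpha:=\neg\alpha\land\circ\alpha$; $\alpha\to\beta:=\ \sim\!\alpha\lor\beta$; $\alpha\leftrightarrow\beta:=(\alpha\to\beta)\land(\beta\to\alpha)$; $\alpha\equiv\beta:=(\alpha\leftrightarrow\beta)\land(\neg\alpha\leftrightarrow\neg\beta)$; $\hat K_i\alpha:=\neg K_i\neg\alpha$. **Proof system AMLFI1** (all schemata range over formulas of $\mathcal{L}_{AM}$, $i\in N$, $p\in P$). LFI1 part: A1 $\alpha\to(\beta\to\alpha)$; A2 $(\alpha\to(\beta\to\gamma))\to((\alpha\to\beta)\to(\alpha\to\gamma))$;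 A3 $\alpha\to(\beta\to(\alpha\land\beta))$; A4 $(\alpha\land\beta)\to\alpha$; A5 $(\alpha\land\beta)\to\beta$; A6 $\alpha\to(\alpha\lor\beta)$; A7 $\beta\to(\alpha\lor\beta)$; A8 $(\alpha\to\gamma)\to((\beta\to\gamma)\to((\alpha\lor\beta)\to\gamma))$; A9 $\alpha\lor(\alpha\to\beta)$; A10 $\alpha\lor\neg\alpha$; A11 $\circ\alpha\to(\alpha\to(\neg\alpha\to\beta))$; A12 $\bullet\alpha\to(\alpha\land\neg\alpha)$; A13 $\neg\neg\alpha\leftrightarrow\alpha$; A14 $\neg(\alpha\lor\beta)\leftrightarrow(\neg\alpha\land\neg\beta)$; A15 $\neg(\alpha\land\beta)\leftrightarrow(\neg\alpha\lor\neg\beta)$; A16 $\neg(\alpha\to\beta)\leftrightarrow(\alpha\land\neg\beta)$; rule MP: $\alpha,\alpha\to\beta\Rightarrow\beta$. Modal (S5LFI1) part: K $K_i(\alpha\to\beta)\to(K_i\alpha\to K_i\beta)$; K$_1$ $K_i(\alpha\to\beta)\to(\hat K_i\alpha\to\hat K_i\beta)$; K$_2$ $\hat K_i(\alpha\lor\beta)\to(\hat K_i\alpha\lor\hat K_i\beta)$; K$_3$ $(\hat K_i\alpha\to K_i\beta)\to K_i(\alpha\to\beta)$; T $K_i\alpha\to\alpha$; 4 $K_i\alpha\to K_iK_i\alpha$; 5 $\hat K_i\alpha\to K_i\hat K_i\alpha$; T$'$ $\alpha\to\hat K_i\alpha$; 4$'$ $\hat K_i\hat K_i\alpha\to\hat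 K_i\alpha$; 5$'$ $\hat K_iK_i\alpha\to K_i\alpha$; rule Nec: $\alpha\Rightarrow K_i\alpha$. Dynamic part: AM1 $[U,e]p\equiv(\mathrm{pre}(e)\to p)$; AM2 $[U,e]\neg\alpha\equiv(\mathrm{pre}(e)\to\neg[U,e]\alpha)$; AM3 $[U,e]\bullet\alpha\equiv(\mathrm{pre}(e)\to\bullet[U,e]\alpha)$; AM4 $[U,e](\alpha\land\beta)\equiv([U,e]\alpha\land[U,e]\beta)$; AM5 $[U,e]K_i\alpha\equiv(\mathrm{pre}(e)\to\bigwedge_{e\sim_i f}K_i[U,f]\alpha)$; rule RE: $\theta\equiv\gamma\Rightarrow\alpha\equiv\alpha(\theta/\gamma)$, where $\alpha(\theta/\gamma)$ is $\alpha$ with occurrences of $\theta$ replaced by $\gamma$ (in $[U,e]\delta$ the replacement acts in $\delta$; the action model is left unchanged). $\Gamma\vdash_{AMLFI1}\alpha$ means there is a finite derivation of $\alpha$ from axioms and members of $\Gamma$, where MP may be applied to any formulas already obtained, while all other rules (Nec, RE) may be applied only to theorems, i.e. formulas derivable from $\emptyset$. **Semantics.** Truth values $\{0,\tfrac12,1\}$, designated values $D=\{1,\tfrac12\}$. A Kripke model is $M=\langle S,\{\sim_i\}_{i\in N},\vartheta\rangle$ with $S$ a set of states, each $\sim_i$ an equivalence relation on $S$, and for each $s\in S$ a map $\vartheta_s:P\to\{0,\tfrac12,1\}$, extended to formulas by: $\vartheta_s(\neg\alpha)=1-\vartheta_s(\alpha)$; $\vartheta_s(\bullet\alpha)=1$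 if $\vartheta_s(\alpha)=\tfrac12$ and $0$ otherwise; $\vartheta_s(\alpha\land\beta)=\min\{\vartheta_s(\alpha),\vartheta_s(\beta)\}$; $\vartheta_s(K_i\alpha)=\inf\{\vartheta_{t}(\alpha):s\sim_i t\}$ (with $\inf\emptyset=1$); $\vartheta_s([U,e]\alpha)=\vartheta'_{(s,e)}(\alpha)$ if $\vartheta_s(\mathrm{pre}(e))\in D$, and $1$ otherwise. Here $\vartheta'$ is the valuation of the updated model $M\otimes U=\langle S',\{\sim_i'\},\vartheta'\rangle$ with $S'=\{(t,f):t\in S,f\in E,\vartheta_t(\mathrm{pre}(f))\in D\}$, $(t,f)\sim'_i(u,g)$ iff $t\sim_i u$ and $f\sim_i g$, and $\vartheta'_{(t,f)}(p)=\vartheta_t(p)$ for $p\in P$. $\Gamma\vDash_{AMLFI1}\alpha$ means: for every such model and every state $s$, if $\vartheta_s(\gamma)\in D$ for all $\gamma\in\Gamma$ then $\vartheta_s(\alpha)\in D$. *)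

(* Defs.v *)
From Corelib Require Import RelationClasses.
From mathcomp Require Import all_boot all_order all_algebra.
From mathcomp Require Import boolp classical_sets.

Set Implicit Arguments.
Unset Strict Implicit.
Unset Printing Implicit Defensive.

Declare Scope am_scope.
Delimit Scope am_scope with am.

Section Language.
Variables (P : countType) (Ag : finType).

Record action_frame := ActionFrame {
  action :> finType;
  arel : Ag -> rel action;
  action_nonempty : 0 < #|action|;
  arel_equiv : forall i, equivalence_rel (arel i)
}.

(* The simultaneous recursion of formulas and action models is encoded by
   letting the update constructor carry the two components of an action model,
   its frame and its precondition map; see [action_model] and [Upd]. *)
Inductive form :=
| Var of P
| Neg of form
| Bul of form
| And of form & form
| Kn of Ag & form
| UpdF (F : action_frame) (pre : F -> form) (e : F) (a : form).

Record action_model := ActionModel {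
  aframe :> action_frame;
  pre : aframe -> form
}.

Definition Upd (U : action_model) (e : U) (a : form) : form :=
  UpdF (@pre U) e a.

Definition Circ (a : form) : form := Neg (Bul a).
Definition Or (a b : form) : form := Neg (And (Neg a) (Neg b)).
Definition SNeg (a : form) : form := And (Neg a) (Circ a).
Definition Imp (a b : form) : form := Or (SNeg a) b.
Definition Iff (a b : form) : form := And (Imp a b) (Imp b a).
Definition Eqv (a b : form) : form := And (Iff a b) (Iff (Neg a) (Neg b)).
Definition Kh (i : Ag) (a : form) : form := Neg (Kn i (Neg a)).

(* The conjunction of the nonempty sequence a :: s, associated to the right. *)
Fixpoint bigAnd (a : form) (s : seq form) : form :=
  if s is b :: s' then And a (bigAnd b s') else a.

(* [replace th g a b]: b is obtained from a by replacing any selection (none,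
   some or all) of the occurrences of th by g, never inside an action model. *)
Inductive replace (th g : form) : form -> form -> Prop :=
| replace_here : replace th g th g
| replace_refl a : replace th g a a
| replace_Neg a b : replace th g a b -> replace th g (Neg a) (Neg b)
| replace_Bul a b : replace th g a b -> replace th g (Bul a) (Bul b)
| replace_And a b c d : replace th g a b -> replace th g c d ->
    replace th g (And a c) (And b d)
| replace_Kn i a b : replace th g a b -> replace th g (Kn i a) (Kn i b)
| replace_Upd (U : action_model) (e : U) a b : replace th g a b ->
    replace th g (Upd e a) (Upd e b).

End Language.

Arguments Var {P Ag}.

Notation "¬ a" := (Neg a) (at level 35, right associativity) : am_scope.
Notation "• a" := (Bul a) (at level 35, right associativity) : am_scope.
Notation "∘ a" := (Circ a) (at level 35, right associativity) : am_scope.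
Notation "a ⋏ b" := (And a b) (at level 40, left associativity) : am_scope.
Notation "a ⋎ b" := (Or a b) (at level 50, left associativity) : am_scope.
Notation "a ⟶ b" := (Imp a b) (at level 55, right associativity) : am_scope.
Notation "a ⟷ b" := (Iff a b) (at level 60, no associativity) : am_scope.
Notation "a ≡ b" := (Eqv a b) (at level 65, no associativity) : am_scope.
Notation "⟦ U , e ⟧ a" := (@Upd _ _ U e a)
  (at level 35, e at level 200, right associativity,
   format "⟦ U ,  e ⟧  a") : am_scope.

Bind Scope am_scope with form.

Section ProofSystem.
Variables (P : countType) (Ag : finType).
Implicit Types (p : P) (i : Ag) (a b c : form P Ag) (G : form P Ag -> Prop).
Local Open Scope am_scope.

Inductive LFI1_axiom : form P Ag -> Prop :=
| A1 a b : LFI1_axiom (a ⟶ (b ⟶ a))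
| A2 a b c : LFI1_axiom ((a ⟶ (b ⟶ c)) ⟶ ((a ⟶ b) ⟶ (a ⟶ c)))
| A3 a b : LFI1_axiom (a ⟶ (b ⟶ (a ⋏ b)))
| A4 a b : LFI1_axiom ((a ⋏ b) ⟶ a)
| A5 a b : LFI1_axiom ((a ⋏ b) ⟶ b)
| A6 a b : LFI1_axiom (a ⟶ (a ⋎ b))
| A7 a b : LFI1_axiom (b ⟶ (a ⋎ b))
| A8 a b c : LFI1_axiom ((a ⟶ c) ⟶ ((b ⟶ c) ⟶ ((a ⋎ b) ⟶ c)))
| A9 a b : LFI1_axiom (a ⋎ (a ⟶ b))
| A10 a : LFI1_axiom (a ⋎ ¬ a)
| A11 a b : LFI1_axiom (∘ a ⟶ (a ⟶ (¬ a ⟶ b)))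
| A12 a : LFI1_axiom (• a ⟶ (a ⋏ ¬ a))
| A13 a : LFI1_axiom (¬ ¬ a ⟷ a)
| A14 a b : LFI1_axiom (¬ (a ⋎ b) ⟷ (¬ a ⋏ ¬ b))
| A15 a b : LFI1_axiom (¬ (a ⋏ b) ⟷ (¬ a ⋎ ¬ b))
| A16 a b : LFI1_axiom (¬ (a ⟶ b) ⟷ (a ⋏ ¬ b)).

Inductive modal_axiom : form P Ag -> Prop :=
| AxK i a b : modal_axiom (Kn i (a ⟶ b) ⟶ (Kn i a ⟶ Kn i b))
| AxK1 i a b : modal_axiom (Kn i (a ⟶ b) ⟶ (Kh i a ⟶ Kh i b))
| AxK2 i a b : modal_axiom (Kh i (a ⋎ b) ⟶ (Kh i a ⋎ Kh i b))
| AxK3 i a b : modal_axiom ((Kh i a ⟶ Kn i b) ⟶ Kn i (a ⟶ b))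
| AxT i a : modal_axiom (Kn i a ⟶ a)
| Ax4 i a : modal_axiom (Kn i a ⟶ Kn i (Kn i a))
| Ax5 i a : modal_axiom (Kh i a ⟶ Kn i (Kh i a))
| AxT' i a : modal_axiom (a ⟶ Kh i a)
| Ax4' i a : modal_axiom (Kh i (Kh i a) ⟶ Kh i a)
| Ax5' i a : modal_axiom (Kh i (Kn i a) ⟶ Kn i a).

Inductive dynamic_axiom : form P Ag -> Prop :=
| AM1 (U : action_model P Ag) (e : U) p :
    dynamic_axiom (⟦U, e⟧ (Var p) ≡ (pre e ⟶ Var p))
| AM2 (U : action_model P Ag) (e : U) a :
    dynamic_axiom (⟦U, e⟧ (¬ a) ≡ (pre e ⟶ ¬ ⟦U, e⟧ a))
| AM3 (U : action_model P Ag) (e : U) a :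
    dynamic_axiom (⟦U, e⟧ (• a) ≡ (pre e ⟶ • ⟦U, e⟧ a))
| AM4 (U : action_model P Ag) (e : U) a b :
    dynamic_axiom (⟦U, e⟧ (a ⋏ b) ≡ (⟦U, e⟧ a ⋏ ⟦U, e⟧ b))
(* U carries no order, so f0 :: fs is an arbitrary enumeration, without
   repetitions, of the (nonempty) class of e; all of them yield an axiom. *)
| AM5 (U : action_model P Ag) (e : U) i a (f0 : U) (fs : seq U) :
    perm_eq (f0 :: fs) (enum [pred f | arel i e f]) ->
    dynamic_axiom (⟦U, e⟧ (Kn i a) ≡
      (pre e ⟶ bigAnd (Kn i (⟦U, f0⟧ a)) [seq Kn i (⟦U, f⟧ a) | f <- fs])).

(* Nec and RE require premises derivable from the empty set. *)
Inductive derives : (form P Ag -> Prop) -> form P Ag -> Prop :=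
| d_LFI1 G a : LFI1_axiom a -> derives G a
| d_modal G a : modal_axiom a -> derives G a
| d_dynamic G a : dynamic_axiom a -> derives G a
| d_hyp G a : G a -> derives G a
| d_MP G a b : derives G a -> derives G (a ⟶ b) -> derives G b
| d_Nec G i a : derives (fun=> False) a -> derives G (Kn i a)
| d_RE G th g a b : derives (fun=> False) (th ≡ g) -> replace th g a b ->
    derives G (a ≡ b).

End ProofSystem.

Inductive tv := V0 | Vhalf | V1.

Definition desig (v : tv) : bool := if v is V0 then false else true.

Definition tv_neg (v : tv) : tv :=
  match v with V0 => V1 | Vhalf => Vhalf | V1 => V0 end.

Definition tv_bul (v : tv) : tv := if v is Vhalf then V1 else V0.

Definition tv_min (u v : tv) : tv :=
  match u, v with
  | V0, _ | _, V0 => V0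
  | Vhalf, _ | _, Vhalf => Vhalf
  | V1, V1 => V1
  end.

Definition tv_inf (A : set tv) : tv :=
  if `[< A V0 >] then V0 else if `[< A Vhalf >] then Vhalf else V1.

(* [tv_val] and the five lemmas after it check the operations above against the
   arithmetic and the order of 0, 1/2, 1. *)
Definition tv_val (v : tv) : rat :=
  match v with V0 => 0 | Vhalf => 1 / 2%:R | V1 => 1 end%R.

Lemma tv_val_neg v : tv_val (tv_neg v) = (1 - tv_val v)%R.
Proof. by apply/eqP; case: v. Qed.

Lemma tv_val_min u v : tv_val (tv_min u v) = Num.min (tv_val u) (tv_val v).
Proof. by apply/eqP; case: u; case: v. Qed.

Lemma tv_inf_lb (A : set tv) v : A v -> (tv_val (tv_inf A) <= tv_val v)%R.
Proof.
rewrite /tv_inf; case: asboolP => [_ _|n0]; first by case: v.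
by case: asboolP => [_|nh]; case: v.
Qed.

Lemma tv_inf_glb (A : set tv) u :
  (forall v, A v -> (tv_val u <= tv_val v)%R) ->
  (tv_val u <= tv_val (tv_inf A))%R.
Proof.
move=> ub; rewrite /tv_inf; case: asboolP => [/ub//|_].
by case: asboolP => [/ub//|_]; case: u {ub}.
Qed.

Lemma tv_inf_set0 : tv_inf set0 = V1.
Proof. by rewrite /tv_inf; do 2 case: asboolP => //. Qed.

Section Semantics.
Variables (P : countType) (Ag : finType).

Record kripke := Kripke {
  state :> Type;
  krel : Ag -> state -> state -> Prop;
  krel_equiv : forall i, Equivalence (krel i);
  kval : state -> P -> tv
}.

(* The updated model relative to the set d of pairs that survive; the Kripke
   model M ⊗ U is obtained in [update] by instantiating d. *)
Section Restrict.
Variables (M : kripke) (F : action_frame Ag) (d : M -> F -> bool).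

Definition ustate := {x : M * F | d x.1 x.2}.

Definition urel (i : Ag) (x y : ustate) : Prop :=
  krel i (sval x).1 (sval y).1 /\ arel i (sval x).2 (sval y).2.

Lemma urel_equiv i : Equivalence (urel i).
Proof.
have [rM sM tM] := @krel_equiv M i; have eF := @arel_equiv _ F i.
split=> [x|x y [xy1 xy2]|x y z [xy1 xy2] [yz1 yz2]]; split.
- exact: rM.
- by case: (eF (sval x).2 (sval x).2 (sval x).2).
- exact: sM.
- have [_ /(_ xy2) <-] := eF (sval x).2 (sval y).2 (sval x).2.
  by case: (eF (sval x).2 (sval x).2 (sval x).2).
- exact: tM yz1.
- by have [_ /(_ xy2) ->] := eF (sval x).2 (sval y).2 (sval z).2.
Qed.

Definition restrict : kripke :=
  Kripke urel_equiv (fun x : ustate => kval (sval x).1).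

End Restrict.

Fixpoint eval (a : form P Ag) (M : kripke) (s : M) {struct a} : tv :=
  match a with
  | Var p => kval s p
  | Neg b => tv_neg (eval b s)
  | Bul b => tv_bul (eval b s)
  | And b c => tv_min (eval b s) (eval c s)
  | Kn i b => tv_inf [set v | exists2 t : M, krel i s t & eval b t = v]
  | @UpdF _ _ F pr e b =>
      let d (t : M) (f : F) := desig (eval (pr f) t) in
      match @idP (d s e) with
      | ReflectT h => @eval b (restrict d) (exist _ (s, e) h)
      | ReflectF _ => V1
      end
  end.

Definition update (M : kripke) (U : action_model P Ag) : kripke :=
  @restrict M U (fun t f => desig (eval (pre f) t)).

Lemma eval_Upd_desig (M : kripke) (U : action_model P Ag) (e : U) a (s : M)
    (h : desig (eval (pre e) s)) :
  eval (Upd e a) s = @eval a (update M U) (exist _ (s, e) h).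
Proof.
by rewrite /=; case: {-}_ / idP => // h'; rewrite (bool_irrelevance h' h).
Qed.

Lemma eval_Upd_ndesig (M : kripke) (U : action_model P Ag) (e : U) a (s : M) :
  ~~ desig (eval (pre e) s) -> eval (Upd e a) s = V1.
Proof. by move=> h /=; case: {-}_ / idP => // h'; rewrite h' in h. Qed.

Definition entails (G : form P Ag -> Prop) (a : form P Ag) : Prop :=
  forall (M : kripke) (s : M),
    (forall g, G g -> desig (eval g s)) -> desig (eval a s).

End Semantics.

(* Main.v *)
(* The connective [Imp a b] takes the value of b when a is designated and 1
   otherwise, and [Eqv a b] is designated exactly when a and b take the same
   value.  So validity of [Eqv th g] is equality of th and g as functions on
   pointed models, a congruence for every constructor, including updates, since
   it holds in the updated models too.  Equalities of infima (axiom AM5) are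
   obtained by comparing lower bounds. *)
Require Import Defs.
From mathcomp Require Import all_boot order ssrnum rat.
From mathcomp Require Import boolp classical_sets.

Set Implicit Arguments.
Unset Strict Implicit.
Unset Printing Implicit Defensive.

Definition tv_le (u v : tv) : bool := (tv_val u <= tv_val v)%R.

Lemma tv_le_min x u v : tv_le x (tv_min u v) = tv_le x u && tv_le x v.
Proof. by rewrite /tv_le tv_val_min Order.TotalTheory.le_min. Qed.

Lemma tv_le_inf x (A : set tv) :
  tv_le x (tv_inf A) <-> forall v, A v -> tv_le x v.
Proof.
split=> [xA v Av|]; last exact: tv_inf_glb.
exact: Order.POrderTheory.le_trans xA (tv_inf_lb Av).
Qed.

Lemma tv_le_ext u v : (forall x, tv_le x u <-> tv_le x v) -> u = v.
Proof.
move=> uv; have e x : tv_le x u = tv_le x v by apply/idP/idP => /uv.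
(* Every value lies above [V0], so the thresholds [Vhalf] and [V1] already separate the three
   values. *)
by move: (e Vhalf) (e V1); case: u {uv e}; case: v.
Qed.

Lemma tv_le_half v : tv_le Vhalf v = desig v.
Proof. by case: v. Qed.

Lemma desig_tv_neg v : desig (tv_neg v) = ~~ tv_le V1 v.
Proof. by case: v. Qed.

Section Soundness.
Variables (P : countType) (Ag : finType).
Implicit Types (a b c : form P Ag) (M : kripke P Ag).

Lemma eval_Imp a b M (s : M) :
  eval (Imp a b) s = if desig (eval a s) then eval b s else V1.
Proof. by rewrite /=; case: (eval a s); case: (eval b s). Qed.

Lemma desig_Imp a b M (s : M) :
  desig (eval (Imp a b) s) <-> (desig (eval a s) -> desig (eval b s)).
Proof. by rewrite eval_Imp; case: (desig (eval a s)); split=> // /(_ isT). Qed.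

Lemma desig_Or a b M (s : M) :
  desig (eval (Or a b) s) = desig (eval a s) || desig (eval b s).
Proof. by rewrite /=; case: (eval a s); case: (eval b s). Qed.

Lemma desig_Eqv a b M (s : M) :
  desig (eval (Eqv a b) s) <-> eval a s = eval b s.
Proof. by rewrite /=; case: (eval a s); case: (eval b s). Qed.

Lemma tv_le_Kn x i a M (s : M) :
  tv_le x (eval (Kn i a) s) <-> forall t, krel i s t -> tv_le x (eval a t).
Proof.
rewrite /= tv_le_inf; split=> [xa t st|xa _ [t st <-]]; last exact: xa.
by apply: xa; exists t.
Qed.

Lemma desig_Kn i a M (s : M) :
  desig (eval (Kn i a) s) <-> forall t, krel i s t -> desig (eval a t).
Proof.
rewrite -tv_le_half tv_le_Kn.
by split=> h t st; move: (h t st); rewrite tv_le_half.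
Qed.

(** Negation exchanges the two thresholds: [tv_neg v] is designated unless [v] is 1, and is 1 unless
    [v] is designated. The two negations in [Kh] thus turn the universal condition for [Kn] into its
    classical dual. *)
Lemma desig_Kh i a M (s : M) :
  desig (eval (Kh i a) s) <-> exists2 t, krel i s t & desig (eval a t).
Proof.
have neg1 t : tv_le V1 (eval (Neg a) t) = ~~ desig (eval a t).
  by move=> /=; case: (eval a t).
rewrite -[eval _ s]/(tv_neg (eval (Kn i (Neg a)) s)) desig_tv_neg.
split=> [/negP h|[t st at_]].
  apply: contrapT => nex; apply: h; apply/tv_le_Kn => t st.
  by rewrite neg1; apply/negP => at_; apply: nex; exists t.
by apply/negP => /tv_le_Kn /(_ t st); rewrite neg1 at_.
Qed.

(** Lower bounds depend only on membership in the list, so the enumeration chosen in [AM5] is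
    immaterial. *)
Lemma tv_le_bigAnd (T : eqType) x (g : T -> form P Ag) f0 fs M (s : M) :
  tv_le x (eval (bigAnd (g f0) (map g fs)) s) <->
  forall f, f \in f0 :: fs -> tv_le x (eval (g f) s).
Proof.
elim: fs f0 => [|f1 fs IH] f0 /=.
  by split=> [h f|]; [rewrite inE => /eqP-> | apply; rewrite mem_head].
rewrite tv_le_min; split=> [/andP[h0 /IH h] f|h].
  by rewrite inE => /predU1P[->|/h].
rewrite h ?mem_head //=; apply/IH => f ffs.
by apply: h; rewrite inE ffs orbT.
Qed.

Lemma eval_replace th g a b :
  (forall M (s : M), eval th s = eval g s) -> replace th g a b ->
  forall M (s : M), eval a s = eval b s.
Proof.
move=> thg; elim=> {a b} //.
- by move=> a b _ IH M s /=; rewrite IH.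
- by move=> a b _ IH M s /=; rewrite IH.
- by move=> a b c d _ IH1 _ IH2 M s /=; rewrite IH1 IH2.
- move=> i a b _ IH M s; apply: tv_le_ext => x.
  by rewrite !tv_le_Kn; split=> h t /h; rewrite IH.
(* Replacement leaves the precondition alone, so one case split serves both sides; when it is
   designated, [IH] is used in the updated model. *)
move=> U e a b _ IH M s; have [h|h] := boolP (desig (eval (pre e) s)).
  by rewrite !(eval_Upd_desig _ h).
by rewrite !eval_Upd_ndesig.
Qed.

Lemma LFI1_axiom_valid a : LFI1_axiom a -> forall M (s : M), desig (eval a s).
Proof.
(* A truth table: the values of the schematic subformulas are abstracted and enumerated. *)
by case=> *; rewrite /=;
  repeat match goal with |- context [eval ?b ?s] => case: (eval b s) end.
Qed.

(** At the level of designation, [Imp], [Or], [Kn] and [Kh] behave classically, so the usual S5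
    arguments apply: reflexivity for T and T', transitivity for 4 and 4', symmetry with transitivity
    for 5 and 5'. *)
Lemma modal_axiom_valid a : modal_axiom a -> forall M (s : M), desig (eval a s).
Proof.
move=> Ha M s.
have [rfl sym trs] :
  [/\ forall i (t : M), krel i t t,
      forall i (t u : M), krel i t u -> krel i u t &
      forall i (t u v : M), krel i t u -> krel i u v -> krel i t v].
  by split=> i; have [? ? ?] := @krel_equiv _ _ M i; eauto.
case: Ha => [i b c|i b c|i b c|i b c|i b|i b|i b|i b|i b|i b].
- apply/desig_Imp => /desig_Kn bc; apply/desig_Imp => /desig_Kn hb.
  by apply/desig_Kn => t st; have /desig_Imp := bc t st; apply; apply: hb.
- apply/desig_Imp => /desig_Kn bc; apply/desig_Imp => /desig_Kh[t st hb].
  by apply/desig_Kh; exists t => //; have /desig_Imp := bc t st; apply.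
- apply/desig_Imp => /desig_Kh[t st]; rewrite !desig_Or => /orP[h|h].
    by apply/orP; left; apply/desig_Kh; exists t.
  by apply/orP; right; apply/desig_Kh; exists t.
- apply/desig_Imp => /desig_Imp bc; apply/desig_Kn => t st.
  apply/desig_Imp => hb; have /desig_Kn : desig (eval (Kn i c) s).
    by apply: bc; apply/desig_Kh; exists t.
  exact.
- by apply/desig_Imp => /desig_Kn; apply.
- apply/desig_Imp => /desig_Kn h; apply/desig_Kn => t st.
  by apply/desig_Kn => u tu; apply: h; apply: trs st tu.
- apply/desig_Imp => /desig_Kh[t st h]; apply/desig_Kn => u su.
  by apply/desig_Kh; exists t => //; apply: trs (sym _ _ _ su) st.
- by apply/desig_Imp => h; apply/desig_Kh; exists s.
- apply/desig_Imp => /desig_Kh[t st /desig_Kh[u tu h]].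
  by apply/desig_Kh; exists u => //; apply: trs st tu.
apply/desig_Imp => /desig_Kh[t st /desig_Kn h]; apply/desig_Kn => u su.
by apply: h; apply: trs (sym _ _ _ st) su.
Qed.

(** The successors of [(s, e)] are the surviving pairs [(t, f)], so the infimum over them splits
    into infima over [t], one for each [f] related to [e]. *)
Lemma eval_Upd_Kn (U : action_model P Ag) (e : U) i a (f0 : U) (fs : seq U)
    M (s : M) :
  f0 :: fs =i [pred f | arel i e f] -> desig (eval (pre e) s) ->
  eval (Upd e (Kn i a)) s =
  eval (bigAnd (Kn i (Upd f0 a)) [seq Kn i (Upd f a) | f <- fs]) s.
Proof.
move=> mem_fs h; rewrite (eval_Upd_desig _ h); apply: tv_le_ext => x.
rewrite tv_le_Kn (tv_le_bigAnd _ (fun f => Kn i (Upd f a))); split=> hx.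
  move=> f; rewrite mem_fs inE => ef; apply/tv_le_Kn => t st.
  have [ht|ht] := boolP (desig (eval (pre f) t)).
    by rewrite (eval_Upd_desig _ ht); apply: hx.
  (* A pair that does not survive contributes the default [V1], which is above every [x]. *)
  by rewrite eval_Upd_ndesig //; case: (x).
case=> [[t f] ht] [/= st ef]; rewrite -(eval_Upd_desig a ht).
have /hx/tv_le_Kn : f \in f0 :: fs by rewrite mem_fs.
exact.
Qed.

Lemma dynamic_axiom_valid a :
  dynamic_axiom a -> forall M (s : M), desig (eval a s).
Proof.
case=> [U e p|U e b|U e b|U e b c|U e i b f0 fs fsE] M s; apply/desig_Eqv;
  rewrite ?eval_Imp; have [h|h] := boolP (desig (eval (pre e) s));
  rewrite ?(eval_Upd_ndesig _ h) //.
- by rewrite (eval_Upd_desig _ h).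
(* Unfolding and refolding [eval] computes the outer connective only and keeps the update formula
   available for rewriting. *)
- by rewrite [RHS]/eval -!/(eval _) !(eval_Upd_desig _ h).
- by rewrite [RHS]/eval -!/(eval _) !(eval_Upd_desig _ h).
- by rewrite [RHS]/eval -!/(eval _) !(eval_Upd_desig _ h).
(* The right-hand side of [AM4] has no guard [pre e]; here both conjuncts are [V1], hence so is
   their minimum. *)
- by rewrite [RHS]/eval -!/(eval _) !(eval_Upd_ndesig _ h).
by apply: eval_Upd_Kn => // f; rewrite (perm_mem fsE) mem_enum.
Qed.

End Soundness.

Theorem theorem36 (P : countType) (Ag : finType)
    (G : form P Ag -> Prop) (a : form P Ag) :
  derives G a -> entails G a.
Proof.
elim=> {G a} [G a h|G a h|G a h|G a Ga|G a b _ IHa _ IHab|G i a _ IH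
             |G th g a b _ IH ab] M s Gs.
- exact: LFI1_axiom_valid.
- exact: modal_axiom_valid.
- exact: dynamic_axiom_valid.
- exact: Gs.
- by have /desig_Imp := IHab M s Gs; apply; apply: IHa.
(* [G] is satisfied at [s] only, but the premises of Nec and RE are derived from the empty set, so
   [IH] holds at every state of every model. *)
- by apply/desig_Kn => t _; apply: IH.
by apply/desig_Eqv; apply: (eval_replace _ ab) => N t; apply/desig_Eqv/IH.
Qed.
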